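(* Let $\mathcal A_1$ and $\mathcal A_2$ be two operator ideals. If $\mathcal A_1$ has the $\ell_\infty$-extension property, or if $\mathcal A_2$ is injective, then $$(\mathcal A_1\circ\mathcal A_2)^{inj}=\mathcal A_1^{inj}\circ\mathcal A_2^{inj}.$$
   Context: Operator ideals are quasi-normed operator ideals $(\mathcal A,\alpha)$ between Banach spaces. Composition: $T\in\mathcal A_1\circ\mathcal A_2(X,Y)$ iff $T=U\circ V$ with $V\in\mathcal A_2(X,Z)$, $U\in\mathcal A_1(Z,Y)$ for some Banach space $Z$. Injective hull: let $B_{Y^*}$ be the closed unit ball of $Y^*$ and $i_Y:Y\hookrightarrow\ell_\infty(B_{Y^*})$, $i_Y(y)=(y^*(y))_{y^*\in B_{Y^*}}$; then $T\in\mathcal A^{inj}(X,Y)$ iff $i_Y\circ T\in\mathcal A(X,\ell_\infty(B_{Y^*}))$. $\mathcal A$ is injective if $\mathcal A^{inj}=\mathcal A$. $\ell_\infty$-extension property of $(\mathcal A,\alpha)$: for every Banach space $X$, set $\Gamma$ and $T\in\mathcal A(X,\ell_\infty(\Gamma))$ there is $\tilde T\in\mathcal A(\ell_\infty(B_{X^*}),\ell_\infty(\Gamma))$ with $T=\tilde T\circ i_X$ and $\alpha(\tilde T)=\alpha(T)$. *)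

(* Defs.v *)
From HB Require Import structures.
From mathcomp Require Import all_boot all_order all_algebra.
From mathcomp Require Import complex.
From mathcomp Require Import all_classical all_reals all_analysis.

Set Implicit Arguments.
Unset Strict Implicit.
Unset Printing Implicit Defensive.

Import Order.TTheory GRing.Theory Num.Theory.
Import numFieldNormedType.Exports.

Local Open Scope classical_set_scope.
Local Open Scope ring_scope.

(* Banach spaces are treated simultaneously over the real and the complex     *)
(* field.                                                                     *)
Variant scalar_kind := RealScalars | ComplexScalars.

Definition scalars (R : realType) (k : scalar_kind) : numFieldType :=
  match k with RealScalars => R | ComplexScalars => (R[i])%C end.

Section scalar_theory.
Variables (R : realType) (k : scalar_kind).
Local Notation K := (scalars R k).

Lemma scalars_has_sup (A : set K) (M : K) :
  A !=set0 -> (forall x, A x -> 0 <= x <= M) -> supremums A !=set0.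
Proof.
case: k A M => /= A M A0 AM.
  have hA : has_sup A.
    by split => //; exists M => x /AM /andP[].
  exists (sup A); split; first exact: sup_upper_bound.
  by move=> y Ay; apply: ge_sup.
have imA x : A x -> x = (complex.Re x)%:C%C.
  by move=> /AM/andP[/ger0_Im x0 _]; case: x x0 => a b /= ->.
have hA : has_sup [set complex.Re x | x in A].
  split; first by case: A0 => x Ax; exists (complex.Re x); exists x.
  exists (complex.Re M) => _ [x /AM /andP[_ +] <-].
  by rewrite lecE => /andP[].
exists (sup [set complex.Re x | x in A])%:C%C; split.
  move=> x Ax; rewrite [x]imA// lecR; apply: sup_upper_bound => //.
  by exists x.
move=> y Ay; case: A0 => a Aa.
rewrite lecE /=; apply/andP; split.
  by have := Ay _ Aa; rewrite [a]imA// lecE /= => /andP[].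
apply: ge_sup; first by case: hA.
by move=> _ [x Ax <-]; have := Ay _ Ax; rewrite lecE => /andP[].
Qed.

Lemma le_scalars_supremum (A : set K) (M x : K) :
  (forall y, A y -> 0 <= y <= M) -> A x -> x <= supremum 0 A.
Proof.
move=> AM Ax; have A0 : A !=set0 by exists x.
rewrite /supremum; case: ifPn => [/eqP A_eq0|_].
  by move: Ax; rewrite A_eq0.
case: xgetP => [s _ [sA _]|/(_ _)]; first exact: sA.
by case: (scalars_has_sup A0 AM) => s ss /(_ s).
Qed.

Lemma scalars_supremum_le (A : set K) (M : K) :
  0 <= M -> (forall y, A y -> 0 <= y <= M) -> supremum 0 A <= M.
Proof.
move=> M0 AM; rewrite /supremum; case: ifPn => // /set0P A0.
case: xgetP => [s _ [_]|/(_ _)]; first by apply => y /AM /andP[].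
by case: (scalars_has_sup A0 AM) => s ss /(_ s).
Qed.

Lemma scalars_complete (F : set_system K^o) :
  ProperFilter F -> cauchy F -> cvg F.
Proof.
case: k F => /= F FF Fc; first exact: R_complete.
have partc (p : R[i]%C -> R) :
    (forall x y, (`|p x - p y|%:C)%C <= `|x - y|) -> cvg (p x @[x --> F]).
  move=> pP; apply: R_complete; apply/cauchy_ballP => e e0.
  have /cauchy_ballP/(_ (e%:C)%C) := Fc.
  rewrite ltcR => /(_ e0) [[P Q] /= [FP FQ] PQ].
  exists (p @` P, p @` Q) => /=.
    by split; rewrite /= /nbhs/=; [apply: filterS FP|apply: filterS FQ] => z;
      exists z.
  move=> [_ _] /= [[x Px <-] [y Qy <-]]; rewrite /ball/= -ltcR.
  by apply: le_lt_trans (pP _ _) _; exact: (PQ (x, y)).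
have /partc/cvg_ex[a Fa] : forall x y : R[i]%C,
    (`|complex.Re x - complex.Re y|%:C)%C <= `|x - y|.
  move=> [a b] [c d]; rewrite normc_def lecR /=.
  by rewrite -sqrtr_sqr ler_wsqrtr// lerDl sqr_ge0.
have /partc/cvg_ex[b Fb] : forall x y : R[i]%C,
    (`|complex.Im x - complex.Im y|%:C)%C <= `|x - y|.
  move=> [a' b'] [c d]; rewrite normc_def lecR /=.
  by rewrite -sqrtr_sqr ler_wsqrtr// lerDr sqr_ge0.
apply/cvg_ex; exists (Complex a b); apply/cvgrPdist_lt => e e0.
have ee : e = ((complex.Re e)%:C)%C.
  by have /ltW/ger0_Im := e0; case: (e) => u v /= ->.
have e0' : 0 < complex.Re e / 2 by move: e0; rewrite ee ltcR => ?; rewrite divr_gt0.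
move/cvgrPdist_lt : Fa => /(_ _ e0') Fa.
move/cvgrPdist_lt : Fb => /(_ _ e0') Fb.
have abP (x : R[i]%C) : `|Complex a b - x| <=
    (`|a - complex.Re x| + `|b - complex.Im x|)%:C%C.
  have -> : Complex a b - x =
      ((a - complex.Re x)%:C + 'i * (b - complex.Im x)%:C)%C.
    by case: x => u v; rewrite [LHS]complexE.
  apply: le_trans (ler_normD _ _) _.
  rewrite normrM !normc_def /= !expr0n /= !addr0 !sqrtr_sqr expr1n add0r.
  by rewrite sqrtr1 mul1r -rmorphD.
near=> x.
apply: le_lt_trans (abP x) _; rewrite ee ltcR [ltRHS]splitr.
by apply: ltrD; near: x.
Unshelve. all: by end_near. Qed.

End scalar_theory.

(* The scalar field as a Banach space over itself.                            *)
Definition scalar_space (R : realType) (k : scalar_kind) :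
    completeNormedModType (scalars R k) :=
  HB.pack ((scalars R k)^o)
    (Uniform_isComplete.Build (scalars R k)^o (@scalars_complete R k)).

Section bounded_operators.
Variables (R : realType) (k : scalar_kind).
Local Notation K := (scalars R k).

Definition bounded_operators (X Y : normedModType K) : set (X -> Y) :=
  [set T | linear T /\ continuous T].

(* Norms take their values in K, so the supremum is taken in K; it exists for *)
(* bounded operators by scalars_has_sup.                                      *)
Definition opnorm (X Y : normedModType K) (T : X -> Y) : K :=
  supremum 0 [set `|T x| | x in [set x : X | `|x| <= 1]].

End bounded_operators.

Section linfty.
Variables (R : realType) (k : scalar_kind) (I : Type).
Local Notation K := (scalars R k).

Definition bounded_functions : {pred I -> K} :=
  mem (bounded_fun : set (I -> K)).

Record linfty := Linfty {
  linfty_fun :> I -> K;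
  linfty_bounded : linfty_fun \in bounded_functions }.

HB.instance Definition _ := [isSub for linfty_fun].
HB.instance Definition _ := [Choice of linfty by <:].

Lemma bounded_functionsP (f : I -> K) :
  (f \in bounded_functions) <-> exists M, forall i, `|f i| <= M.
Proof.
rewrite inE; split => [/pinfty_ex_gt0[M _ fM]|[M fM]].
  by exists M => i; exact: fM.
exists `|M|; split=> [|y My i _]; first exact: normr_real.
have M0 : 0 <= M by apply: le_trans (fM i); exact: normr_ge0.
by apply: le_trans (fM i) _; rewrite -(ger0_norm M0) ltW.
Qed.

Fact bounded_functions_submod_closed : submod_closed bounded_functions.
Proof.
split; first by apply/bounded_functionsP; exists 0 => i; rewrite normr0.
move=> c f g /bounded_functionsP[M fM] /bounded_functionsP[N gN].
apply/bounded_functionsP; exists (`|c| * M + N) => i.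
by rewrite (le_trans (ler_normD _ _))// lerD// normrM ler_wpM2l.
Qed.

HB.instance Definition _ := GRing.isSubmodClosed.Build K (I -> K)
  bounded_functions bounded_functions_submod_closed.
HB.instance Definition _ := [SubChoice_isSubLmodule of linfty by <:].

Definition linfty_norm (f : linfty) : K := supremum 0 (range (fun i => `|f i|)).

Lemma linfty_normP (f : linfty) i : `|f i| <= linfty_norm f.
Proof.
have /bounded_functionsP[M fM] := linfty_bounded f.
apply: (@le_scalars_supremum _ _ _ M); last by exists i.
by move=> _ [j _ <-]; rewrite normr_ge0 fM.
Qed.

Lemma linfty_norm_le (f : linfty) (M : K) :
  0 <= M -> (forall i, `|f i| <= M) -> linfty_norm f <= M.
Proof.
move=> M0 fM; apply: scalars_supremum_le => // _ [j _ <-].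
by rewrite normr_ge0 fM.
Qed.

Lemma linfty_norm_ge0 (f : linfty) : 0 <= linfty_norm f.
Proof.
have [[j]|I0] := pselect (inhabited I).
  by apply: le_trans (linfty_normP f j); exact: normr_ge0.
rewrite /linfty_norm.
suff -> : range (fun i => `|f i|) = set0 by rewrite supremum0.
by apply/seteqP; split => // x [j]; case: I0; exact: inhabits j.
Qed.

Lemma linfty_norm_triangle (f g : linfty) :
  linfty_norm (f + g) <= linfty_norm f + linfty_norm g.
Proof.
apply: linfty_norm_le => [|i]; first by rewrite addr_ge0 ?linfty_norm_ge0.
by rewrite (le_trans (ler_normD _ _))// lerD ?linfty_normP.
Qed.

Lemma linfty_normZ (c : K) (f : linfty) :
  linfty_norm (c *: f) = `|c| * linfty_norm f.
Proof.
have le_norm (a : K) (g : linfty) :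
    linfty_norm (a *: g) <= `|a| * linfty_norm g.
  apply: linfty_norm_le => [|i]; first by rewrite mulr_ge0 ?linfty_norm_ge0.
  by rewrite normrM ler_wpM2l ?linfty_normP.
have [->|c0] := eqVneq c 0.
  apply/eqP; rewrite eq_le le_norm normr0 mul0r.
  exact: linfty_norm_ge0.
apply/eqP; rewrite eq_le le_norm /= -ler_pdivlMl ?normr_gt0//.
by rewrite -normfV (le_trans _ (le_norm _ _))// scalerA mulVf// scale1r.
Qed.

Lemma linfty_norm_eq0 (f : linfty) : linfty_norm f = 0 -> f = 0.
Proof.
move=> f0; apply/val_inj/funext => i; apply/eqP.
by rewrite -normr_le0 -f0 linfty_normP.
Qed.

HB.instance Definition _ := Lmodule_isNormed.Build K linfty
  linfty_norm_triangle linfty_normZ linfty_norm_eq0.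

Fact linfty_complete (F : set_system linfty) :
  ProperFilter F -> cauchy F -> cvg F.
Proof.
move=> FF /cauchy_ballP Fc.
have Fi i : cvg ((fun f : linfty => f i : K^o) @ F).
  apply: scalars_complete; apply/cauchy_ballP => e e0.
  have [[P Q] /= [FP FQ] PQ] := Fc _ e0.
  exists ((fun f : linfty => f i : K^o) @` P,
          (fun f : linfty => f i : K^o) @` Q) => /=.
    by split; rewrite /= /nbhs/=; [apply: filterS FP|apply: filterS FQ] => z;
      exists z.
  move=> [_ _] /= [[x Px <-] [y Qy <-]]; rewrite /ball/=.
  apply: le_lt_trans (linfty_normP (x - y) i) _.
  by have := PQ (x, y) (conj Px Qy); rewrite -ball_normE.
pose h i : K := lim ((fun f : linfty => f i : K^o) @ F).
have Fh (e : K) : 0 < e ->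
    F [set f : linfty | forall i, `|h i - f i| <= e].
  move=> e0; have e20 : 0 < e / 2 by rewrite divr_gt0.
  have [[P Q] /= [FP FQ] PQ] := Fc _ e20.
  apply: filterS (FQ) => f Qf i.
  have /cvgrPdist_lt/(_ _ e20) Fhi := Fi i.
  have [g [Pg hg]] := filter_ex (filterI FP Fhi).
  rewrite -(subrKA (g i)) (le_trans (ler_normD _ _))// [leRHS]splitr lerD//.
    exact: ltW.
  apply: le_trans (linfty_normP (g - f) i) _; apply: ltW.
  by have := PQ (g, f) (conj Pg Qf); rewrite -ball_normE.
have hb : h \in bounded_functions.
  have [f fh] := filter_ex (Fh 1 ltr01).
  apply/bounded_functionsP; exists (1 + linfty_norm f) => i.
  rewrite -(subrK (f i) (h i)) (le_trans (ler_normD _ _))// lerD//.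
  exact: linfty_normP.
apply/cvg_ex; exists (Linfty hb); apply/cvgrPdist_le => e e0.
apply: filterS (Fh _ e0) => f hf.
by apply: linfty_norm_le => //; exact: ltW.
Qed.

HB.instance Definition _ := Uniform_isComplete.Build linfty linfty_complete.

End linfty.

Section canonical_embedding.
Variables (R : realType) (k : scalar_kind).
Local Notation K := (scalars R k).
Variable X : completeNormedModType K.

(* The closed unit ball of the dual of X.                                     *)
Definition dual_ball : Type :=
  {f : X -> scalar_space R k | bounded_operators f /\ opnorm f <= 1}.

Lemma dual_ballP (f : dual_ball) (x : X) : `|proj1_sig f x| <= `|x|.
Proof.
case: f => f [[fl fc] f1] /=.
pose fL : {linear X -> scalar_space R k} :=
  HB.pack f (GRing.isLinear.Build K X (scalar_space R k) *:%R f fl).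
have f0 : f 0 = 0 by exact: (linear0 fL).
have fZ c y : f (c *: y) = c *: f y by exact: (linearZ_LR fL).
have [r r0 fr] : exists2 r : K, 0 < r & forall y, `|fL y| <= r * `|y|.
  apply: pinfty_ex_gt0; apply/linear_boundedP.
  by apply: continuous_linear_bounded; exact: fc.
have [->|x0] := eqVneq x 0; first by rewrite f0 !normr0.
have x_gt0 : 0 < `|x| by rewrite normr_gt0.
rewrite -[leRHS]mulr1 -ler_pdivrMl//.
have -> : `|x|^-1 * `|f x| = `|f (`|x|^-1 *: x)|.
  by rewrite fZ normrZ normfV normr_id.
apply: le_trans f1; apply: (@le_scalars_supremum _ _ _ r).
  move=> _ [y /= y1 <-]; rewrite normr_ge0; apply: le_trans (fr y) _.
  by rewrite ler_piMr// ltW.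
by exists (`|x|^-1 *: x) => //=; rewrite normfZV.
Qed.

Fact dual_evaluation_bounded (x : X) :
  (fun f : dual_ball => proj1_sig f x) \in @bounded_functions R k dual_ball.
Proof. by apply/bounded_functionsP; exists `|x| => f; exact: dual_ballP. Qed.

Definition canonical_embedding (x : X) : linfty R k dual_ball :=
  Linfty (dual_evaluation_bounded x).

End canonical_embedding.

Section operator_ideals.
Variables (R : realType) (k : scalar_kind).
Local Notation K := (scalars R k).
Local Notation banach := (completeNormedModType K).

Definition operator_class : Type := forall X Y : banach, set (X -> Y).

(* Quasi-normed operator ideals. The quasi-norm is K-valued, as norms are;    *)
(* over the complex field, 0 <= z means that z is a nonnegative real. Only    *)
(* the values of ideal_qnorm on members of the ideal are meaningful.          *)
Record operator_ideal : Type := OperatorIdeal {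
  ideal_class :> operator_class;
  ideal_qnorm : forall X Y : banach, (X -> Y) -> K;

  ideal_bounded (X Y : banach) (T : X -> Y) :
    ideal_class T -> bounded_operators T;
  ideal_id : ideal_class (@idfun (scalar_space R k));
  ideal_add (X Y : banach) (S T : X -> Y) :
    ideal_class S -> ideal_class T -> ideal_class (fun x => S x + T x);
  ideal_comp (X0 X Y Y0 : banach) (U : X0 -> X) (T : X -> Y) (V : Y -> Y0) :
    bounded_operators U -> ideal_class T -> bounded_operators V ->
    ideal_class (V \o T \o U);

  qnorm_ge0 (X Y : banach) (T : X -> Y) :
    ideal_class T -> 0 <= ideal_qnorm T;
  qnorm_eq0 (X Y : banach) (T : X -> Y) :
    ideal_class T -> ideal_qnorm T = 0 -> forall x, T x = 0;
  qnormZ (X Y : banach) (c : K) (T : X -> Y) :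
    ideal_class T -> ideal_qnorm (fun x => c *: T x) = `|c| * ideal_qnorm T;
  qnorm_triangle : exists2 kappa : K, 1 <= kappa &
    forall (X Y : banach) (S T : X -> Y), ideal_class S -> ideal_class T ->
      ideal_qnorm (fun x => S x + T x)
        <= kappa * (ideal_qnorm S + ideal_qnorm T);
  qnorm_id : ideal_qnorm (@idfun (scalar_space R k)) = 1;
  qnorm_comp (X0 X Y Y0 : banach) (U : X0 -> X) (T : X -> Y) (V : Y -> Y0) :
    bounded_operators U -> ideal_class T -> bounded_operators V ->
    ideal_qnorm (V \o T \o U) <= opnorm V * ideal_qnorm T * opnorm U }.

Definition ideal_composition (A1 A2 : operator_class) : operator_class :=
  fun X Y => [set T | exists (Z : banach) (V : X -> Z) (U : Z -> Y),
    [/\ A2 X Z V, A1 Z Y U & T = U \o V]].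

Definition injective_hull (A : operator_class) : operator_class :=
  fun X Y => [set T | bounded_operators T /\
    A X (linfty R k (dual_ball Y)) (@canonical_embedding R k Y \o T)].

(* Equality of classes of operators; quasi-norms are not compared.            *)
Definition injective_ideal (A : operator_class) : Prop :=
  injective_hull A = A.

Definition linfty_extension_property (A : operator_ideal) : Prop :=
  forall (X : banach) (I : Type) (T : X -> linfty R k I), ideal_class A T ->
  exists T' : linfty R k (dual_ball X) -> linfty R k I,
    [/\ ideal_class A T', T = T' \o @canonical_embedding R k X
      & ideal_qnorm A T' = ideal_qnorm A T].

End operator_ideals.

(* Main.v *)
(* If i_Y T = U V with V in A2(X,Z) and U in A1(Z, l_infty(B_{Y^*})), then V  *)
(* takes values in the closed subspace W = U^{-1}(i_Y(Y)) of Z, on which U    *)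
(* factors as i_Y U0, so that T = U0 V0 with V0 the corestriction of V to W.  *)
(* Here U0 is in A1^inj since i_Y U0 is a restriction of U, and V0 is in      *)
(* A2^inj since i_W extends to Z by Hahn-Banach. For the converse inclusion,  *)
(* i_Y U V equals U' (i_Z V), where U' is the extension of i_Y U, or, when A2 *)
(* is injective, (i_Y U) V with V in A2.                                      *)
From HB Require Import structures.
Require Import Defs.
From mathcomp Require Import all_boot all_order all_algebra.
From mathcomp Require Import complex.
From mathcomp Require Import all_classical all_reals all_analysis.

Set Implicit Arguments.
Unset Strict Implicit.
Unset Printing Implicit Defensive.

Import Order.TTheory GRing.Theory Num.Theory.
Import numFieldNormedType.Exports.

Local Open Scope classical_set_scope.
Local Open Scope ring_scope.

(** The embedding into [linfty] is isometric ([norm_canonical_embedding]), so its range is closed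
    ([canonical_range_closed]), and the preimage W of that range under U is itself a Banach space.
    This gives a middle space for the factorization in [injective_hull_composition_sub]. An operator
    into [linfty] is a bounded family of functionals, so Hahn-Banach applied to each coordinate
    extends the embedding of W to all of Z ([canonical_embedding_extend]). In the other direction
    the difficulty is that V may enter the second ideal only after embedding Z; the hypothesis of
    [composition_injective_hull_sub] either moves that embedding across from U or removes it. *)

(** * Real Hahn-Banach theorem with a sublinear majorant *)

Section real_hahn_banach.
Variables (R : realType) (V : lmodType R) (p : V -> R).
Hypothesis pD : forall x y, p (x + y) <= p x + p y.
Hypothesis pZ : forall a x, 0 <= a -> p (a *: x) = a * p x.

Definition dominated_graph (G : set (V * R^o)) :=
  (forall a u w, G u -> G w -> G (a *: u + w)) /\
  (forall u, G u -> u.2 <= p u.1).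

(** The difference of two values at v is a value at 0, hence at most p 0 = 0; by symmetry the values
    agree. *)
Lemma dominated_graph_functional (G : set (V * R^o)) v r s :
  dominated_graph G -> G (v, r) -> G (v, s) -> r = s.
Proof.
move=> [Gl Gp] Gr Gs.
have p0 : p 0 = 0 by rewrite -(scale0r 0) pZ// mul0r.
have le t t' : G (v, t) -> G (v, t') -> t <= t'.
  move=> Gt Gt'; have /Gp := Gl (-1) _ _ Gt' Gt.
  by rewrite /= !scaleN1r addNr p0 addrC subr_le0.
by apply/eqP; rewrite eq_le !le.
Qed.

(** The value c at v must lie above every u.2 - p (u.1 - v) and below every p (w.1 + v) - w.2.
    Subadditivity puts each lower bound below each upper bound, so the supremum of the lower ones
    works. *)
Lemma dominated_graph_extend (G : set (V * R^o)) v : G !=set0 ->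
  dominated_graph G -> exists c : R,
  dominated_graph [set w | exists u t, G u /\ w = u + t *: (v, c : R^o)].
Proof.
move=> [u0 Gu0] [Gl Gp].
pose A := [set u.2 - p (u.1 - v) | u in G].
have Aub w : G w -> ubound A (p (w.1 + v) - w.2).
  move=> Gw _ [u Gu <-]; rewrite lerBlDr addrAC lerBrDr.
  rewrite (addrC (p _) (p _)); apply: le_trans (pD _ _).
  rewrite addrACA addNr addr0.
  by have /= := Gp _ (Gl 1 _ _ Gu Gw); rewrite !scale1r.
have A0 : A !=set0 by exists (u0.2 - p (u0.1 - v)), u0.
have Asup : has_sup A by split => //; eexists; exact: Aub Gu0.
exists (sup A); split.
  move=> a _ _ [u [t [Gu ->]]] [w [t' [Gw ->]]].
  exists (a *: u + w), (a * t + t'); split; first exact: Gl.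
  by rewrite scalerDr scalerA [in RHS]scalerDl addrACA.
have GZ a u : G u -> G (a *: u).
  move=> Gu; have := Gl (a - 1) _ _ Gu Gu.
  by rewrite -[X in _ + X]scale1r -scalerDl subrK.
(* Dividing by the absolute value of t reduces to t = 1, where the upper bounds on c apply, or t =
   -1, where the lower ones do. *)
move=> _ [u [t [Gu ->]]] /=; have [t0|t0|->] := ltgtP t 0; last first.
- by rewrite !scale0r !addr0; exact: Gp.
- have := ge_sup A0 (Aub _ (GZ t^-1 _ Gu)) => /=.
  rewrite -(ler_pM2l t0) mulrBr -pZ ?(ltW t0)// scalerDr !scalerA.
  rewrite divff ?gt_eqF//.
  by rewrite scale1r mulrA divff ?gt_eqF// mul1r lerBrDl.
- have s0 : 0 < - t by rewrite oppr_gt0.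
  have := sup_upper_bound Asup (imageP _ (GZ (- t)^-1 _ Gu)).
  rewrite /= -(ler_pM2l s0) mulrBr -pZ ?(ltW s0)// scalerBr !scalerA.
  rewrite divff ?gt_eqF//.
  rewrite scale1r mulrA divff ?gt_eqF// mul1r scaleNr opprK.
  by rewrite lerBlDr mulNr -lerBlDl opprK.
Qed.

(** The subspace is presented as the image of a map j, not assumed injective; domination makes f
    vanish on the kernel of j. Zorn's lemma gives a maximal dominated graph. *)
Lemma real_hahn_banach (W : lmodType R) (j : {linear W -> V})
    (f : {linear W -> R^o}) : (forall w, f w <= p (j w)) ->
  exists g : {linear V -> R^o},
    (forall w, g (j w) = f w) /\ (forall v, g v <= p v).
Proof.
move=> fp; pose G0 : set (V * R^o) := range (fun w => (j w, f w)).
have G0l a u w : G0 u -> G0 w -> G0 (a *: u + w).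
  by move=> [x _ <-] [y _ <-]; exists (a *: x + y) => //; rewrite !linearP.
have G0p u : G0 u -> u.2 <= p u.1 by move=> [x _ <-]; exact: fp.
(* Graphs required to contain G0 are not closed under the union of the empty  *)
(* chain; adding G0 to an arbitrary graph avoids this.                        *)
have [|A [GA maxA]] :=
    @Zorn_bigcup _ [set A : set (V * R^o) | dominated_graph (A `|` G0)].
  move=> F FP Ftot; split; last first.
    move=> u [[A FA Au]|]; last exact: G0p.
    by apply: (FP A FA).2; left.
  have FG0 A a u w : F A -> (A `|` G0) u -> (A `|` G0) w ->
      (\bigcup_(X in F) X `|` G0) (a *: u + w).
    move=> FA Au Aw; have [AX|] := (FP A FA).1 a u w Au Aw; last by right.
    by left; exists A.
  move=> a u w [[A FA Au]|G0u] [[B FB Bw]|G0w].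
  - have [AB|BA] := Ftot _ _ FA FB.
    + by apply: FG0 FB _ _; left => //; exact: AB.
    + by apply: FG0 FA _ _; left => //; exact: BA.
  - by apply: FG0 FA _ _; [left|right].
  - by apply: FG0 FB _ _; [right|left].
  - by right; exact: G0l.
pose G := A `|` G0; have G00 : G (0, 0) by right; exists 0; rewrite ?linear0.
(* If (v, c) were missing from G, the one-dimensional extension B would strictly contain A, against
   maximality. *)
have total v : exists r, G (v, r).
  have [c [Bl Bp]] := dominated_graph_extend v (ex_intro _ _ G00) GA.
  set B := (X in forall a u w, X u -> X w -> _) in Bl.
  have GB : G `<=` B by move=> u Gu; exists u, 0; rewrite scale0r addr0.
  have Bv : B (v, c) by exists (0, 0), 1; rewrite scale1r add0r.
  exists c; apply: contrapT => nGv; apply: (maxA B).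
    split; first by apply: subset_trans GB => ?; left.
    by move=> /(_ _ Bv) Av; apply: nGv; left.
  have BG0 : B `|` G0 = B.
    by apply/setUidPl; apply: subset_trans GB => ?; right.
  by rewrite /= BG0.
have [g gG] := choice total.
have gl : linear g.
  move=> a u w; have GD := GA.1 a _ _ (gG u) (gG w).
  exact: dominated_graph_functional GA (gG _) GD.
pose gL : {linear V -> R^o} :=
  HB.pack g (GRing.isLinear.Build R V R^o *:%R g gl).
exists gL; split => [w|v].
  by apply: dominated_graph_functional GA (gG _) _; right; exists w.
exact: GA.2 _ (gG v).
Qed.

End real_hahn_banach.

(** * Complex Hahn-Banach theorem by restriction of scalars *)

Section complex_hahn_banach.
Variable R : realType.
Local Notation C := (R[i])%C.

Definition realification (V : lmodType C) : Type := V.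

Section realification_lmodule.
Variable V : lmodType C.
HB.instance Definition _ := GRing.Zmodule.copy (realification V) V.
Definition real_scale (a : R) (v : realification V) : realification V :=
  (a%:C)%C *: (v : V).
Lemma real_scaleA a b v : real_scale a (real_scale b v) = real_scale (a * b) v.
Proof. by rewrite /real_scale scalerA -rmorphM. Qed.
Lemma real_scale1 : left_id 1 real_scale.
Proof. by move=> v; exact: scale1r. Qed.
Lemma real_scaleDr : right_distributive real_scale +%R.
Proof. by move=> a u v; exact: scalerDr. Qed.
Lemma real_scaleDl v : {morph real_scale^~ v : a b / a + b}.
Proof. by move=> a b; rewrite /real_scale rmorphD; exact: scalerDl. Qed.
HB.instance Definition _ := GRing.Zmodule_isLmodule.Build R (realification V)
  real_scaleA real_scale1 real_scaleDr real_scaleDl.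
End realification_lmodule.

(** A complex functional is determined by its real part u through g v = u v - i u (i v). So the real
    part of f is extended, and g is rebuilt by this formula. *)
Lemma complex_hahn_banach (V : normedModType C) (W : lmodType C)
    (j : {linear W -> V}) (f : {linear W -> C^o}) :
  (forall w, `|f w| <= `|j w|) ->
  exists g : {linear V -> C^o},
    (forall w, g (j w) = f w) /\ (forall v, `|g v| <= `|v|).
Proof.
move=> fj.
have normE (U : normedZmodType C) (x : U) : `|x| = (complex.Re `|x|)%:C%C.
  by have /ger0_Im := normr_ge0 x; case: `|x| => a b /= ->.
have Re_le (x y : C) : x <= y -> complex.Re x <= complex.Re y.
  by rewrite lecE => /andP[].
have ReZ (a : R) (x : C) : complex.Re (a%:C%C * x) = a * complex.Re x.
  by case: x => x y /=; rewrite mul0r subr0.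
have ReD (x y : C) : complex.Re (x + y) = complex.Re x + complex.Re y.
  by case: x; case: y.
pose p (v : realification V) : R := complex.Re `|v : V|.
have pD x y : p (x + y) <= p x + p y.
  by rewrite -ReD; apply: Re_le; exact: ler_normD.
have pZ a x : 0 <= a -> p (a *: x) = a * p x.
  by move=> a0; rewrite -ReZ /p [_ *: _]/(_ *: _) normrZ ger0_norm ?lecR.
have jl : linear (j : realification W -> realification V).
  by move=> a u v; exact: linearP.
pose jR : {linear realification W -> realification V} :=
  HB.pack (j : realification W -> realification V)
    (GRing.isLinear.Build R (realification W) (realification V) *:%R _ jl).
pose fR0 (w : realification W) : R^o := complex.Re (f w).
have fl : linear fR0.
  move=> a u v; rewrite /fR0 [a *: u]/(_ *: _) linearP ReD; congr (_ + _).
  exact: ReZ.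
pose fR : {linear realification W -> R^o} :=
  HB.pack fR0 (GRing.isLinear.Build R (realification W) R^o *:%R _ fl).
have fp w : fR w <= p (jR w).
  apply: le_trans (Re_le _ _ (fj w)).
  rewrite -lecR -normE; apply: le_trans (normc_ge_Re _).
  by rewrite lecR ler_norm.
have [u [uj up]] := real_hahn_banach pD pZ fp.
pose g (v : V) : C^o := Complex (u v) (- u ('i%C *: v : V)).
have gD x y : g (x + y) = g x + g y.
  by rewrite /g scalerDr [u _]linearD [u (_ + _)]linearD opprD.
have gR (a : R) x : g (a%:C%C *: x) = a%:C%C * g x.
  rewrite /g scalerA mulrC -scalerA.
  rewrite (linearZ_LR u a x) (linearZ_LR u a ('i%C *: x)) /=.
  by apply/eqP; rewrite eq_complex /= !mul0r subr0 addr0 mulrN !eqxx.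
have gi x : g ('i%C *: x) = 'i%C * g x.
  rewrite /g scalerA -expr2 sqr_i scaleN1r [u (- _)]linearN.
  by apply/eqP; rewrite eq_complex /= !mul0r !mul1r !sub0r !add0r !opprK !eqxx.
have gl : linear g.
  move=> c x y; rewrite gD; congr (_ + _).
  by rewrite (complexE c) !scalerDl gD -!scalerA gi !gR.
pose gL : {linear V -> C^o} :=
  HB.pack g (GRing.isLinear.Build C V C^o *:%R g gl).
exists gL; split=> [w|v].
  have uE x : u (j x) = complex.Re (f x) := uj x.
  rewrite /= /g -linearZ !uE linearZ /=.
  by case: (f w) => a b /=; rewrite mul0r mul1r sub0r opprK.
have [gv0|gv0] := eqVneq (gL v) 0; first by rewrite gv0 normr0.
(* Rotating v by c makes g real there, where g coincides with u <= p. *)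
pose c := `|gL v| / gL v.
have c1 : `|c| = 1 by rewrite normrM normfV normr_id divff// normr_eq0.
have gc : gL (c *: v) = `|gL v| by rewrite linearZ; exact: divfK.
have -> : `|v| = `|c *: v| by rewrite normrZ c1 mul1r.
rewrite normE -gc [leRHS]normE lecR.
exact: up.
Qed.
End complex_hahn_banach.

(** * Bounded operators and the canonical embedding *)

Section bounded_operators_theory.
Variables (R : realType) (k : scalar_kind).
Local Notation K := (scalars R k).
Local Notation banach := (completeNormedModType K).

Lemma hahn_banach (V : normedModType K) (W : lmodType K)
    (j : {linear W -> V}) (f : {linear W -> K^o}) :
  (forall w, `|f w| <= `|j w|) ->
  exists g : {linear V -> K^o},
    (forall w, g (j w) = f w) /\ (forall v, `|g v| <= `|v|).
Proof.
case: k V W j f => /= V W j f fj; last exact: complex_hahn_banach.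
have pZ (a : R) (x : V) : 0 <= a -> `|a *: x| = a * `|x|.
  by move=> a0; rewrite normrZ ger0_norm.
have [w|g [gj gp]] := real_hahn_banach (@ler_normD _ V) pZ (j := j) (f := f).
  exact: le_trans (ler_norm _) (fj w).
exists g; split=> // v; rewrite ler_norml gp andbT lerNl -linearN.
by rewrite (le_trans (gp _))// normrN.
Qed.

Lemma bounded_operators_le (X Y : normedModType K) (T : X -> Y) (C : K) :
  linear T -> (forall x, `|T x| <= C * `|x|) -> bounded_operators T.
Proof.
move=> Tl TC; split=> //.
pose TL : {linear X -> Y} := HB.pack T (GRing.isLinear.Build K X Y *:%R T Tl).
apply: (@bounded_linear_continuous _ _ _ TL); apply/linear_boundedP.
(* The sign of C is not given, nor that C is real, so [|C|] serves as threshold; any nonzero x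
   forces 0 <= C. *)
have C1 : `|C| \is Num.real by exact: normr_real.
exists `|C|; split=> // r /ltW Cr x.
have [->|x0] := eqVneq x 0; first by rewrite linear0 !normr0 mulr0.
have C0 : 0 <= C.
  by rewrite -(pmulr_lge0 _ (x := `|x|)) ?normr_gt0// (le_trans _ (TC x)).
by apply: le_trans (TC x) _; rewrite ler_wpM2r// -(ger0_norm C0).
Qed.

Lemma bounded_operators_bound (X Y : normedModType K) (T : X -> Y) :
  bounded_operators T ->
  exists2 r : K, 0 < r & forall x, `|T x| <= r * `|x|.
Proof.
move=> [Tl Tc].
pose TL : {linear X -> Y} := HB.pack T (GRing.isLinear.Build K X Y *:%R T Tl).
apply: pinfty_ex_gt0; apply/(@linear_boundedP _ _ _ TL).
by apply: continuous_linear_bounded; exact: Tc.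
Qed.

Lemma bounded_operators_comp (X Y Z : normedModType K)
    (T : X -> Y) (S : Y -> Z) :
  bounded_operators T -> bounded_operators S -> bounded_operators (S \o T).
Proof.
move=> [Tl Tc] [Sl Sc]; split=> [a x y|x]; first by rewrite /= Tl Sl.
by apply: continuous_comp; [exact: Tc|exact: Sc].
Qed.

Lemma dual_ball_intro (X : banach) (g : {linear X -> K^o}) :
  (forall x, `|g x| <= `|x|) ->
  exists f : dual_ball X, forall x, proj1_sig f x = g x.
Proof.
move=> gle; have gb : bounded_operators (g : X -> scalar_space R k).
  apply: (@bounded_operators_le X (scalar_space R k) g 1) => [a x y|x].
    exact: linearP.
  by rewrite mul1r.
have g1 : opnorm (g : X -> scalar_space R k) <= 1.
  apply: scalars_supremum_le => // _ [x /= x1 <-].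
  by rewrite normr_ge0 (le_trans _ x1).
by exists (exist _ (g : X -> scalar_space R k) (conj gb g1)).
Qed.

Lemma canonical_embedding_linear (X : banach) :
  linear (@canonical_embedding R k X).
Proof.
by move=> a x y; apply/val_inj/funext => -[f [[fl fc] f1]] /=; exact: fl.
Qed.

(** The lower bound needs a norming functional: Hahn-Banach extends c x |-> c |x| from the line
    spanned by x. *)
Lemma norm_canonical_embedding (X : banach) (x : X) :
  `|canonical_embedding x| = `|x|.
Proof.
apply/eqP; rewrite eq_le; apply/andP; split.
  by apply: linfty_norm_le => // f; exact: dual_ballP.
pose j0 (c : K^o) : X := c *: x.
pose f0 (c : K^o) : K^o := c * `|x|.
have jl : linear j0 by move=> a u v; rewrite /j0 scalerDl scalerA.
have fl : linear f0 by move=> a u v; rewrite /f0 mulrDl -mulrA.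
pose j : {linear K^o -> X} :=
  HB.pack j0 (GRing.isLinear.Build K K^o X *:%R j0 jl).
pose f : {linear K^o -> K^o} :=
  HB.pack f0 (GRing.isLinear.Build K K^o K^o *:%R f0 fl).
have [w|g [gj gle]] := hahn_banach (j := j) (f := f).
  by rewrite /= /j0 /f0 normrM normr_id normrZ.
have [h hg] := dual_ball_intro gle.
have := linfty_normP (canonical_embedding x) h; rewrite /= hg.
have := gj 1; rewrite /= /j0 /f0 scale1r mul1r => ->.
by rewrite normr_id.
Qed.

Lemma canonical_embedding_inj (X : banach) :
  injective (@canonical_embedding R k X).
Proof.
move=> x y xy; apply/eqP; rewrite -subr_eq0 -normr_eq0.
rewrite -norm_canonical_embedding.
by rewrite -scaleN1r addrC canonical_embedding_linear xy scaleN1r addNr normr0.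
Qed.

Lemma canonical_embedding_bounded (X : banach) :
  bounded_operators (@canonical_embedding R k X).
Proof.
apply: (@bounded_operators_le _ _ _ 1); first exact: canonical_embedding_linear.
by move=> x; rewrite mul1r norm_canonical_embedding.
Qed.

End bounded_operators_theory.

(** * Closed subspaces as Banach spaces *)

Section closed_submodule.
Variables (K : numFieldType) (Z : completeNormedModType K).

Record closed_submodule := ClosedSubmodule {
  closed_submodule_pred :> {pred Z};
  closed_submodule_submod : submod_closed closed_submodule_pred;
  closed_submodule_closed : closed [set` closed_submodule_pred] }.

Variable W : closed_submodule.

HB.instance Definition _ := GRing.isSubmodClosed.Build K Z
  (closed_submodule_pred W) (closed_submodule_submod W).

Record closed_subspace := ClosedSubspace {
  closed_subspace_val :> Z;
  closed_subspaceP : closed_subspace_val \in closed_submodule_pred W }.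

HB.instance Definition _ := [isSub for closed_subspace_val].
HB.instance Definition _ := [Choice of closed_subspace by <:].
HB.instance Definition _ := [SubChoice_isSubLmodule of closed_subspace by <:].

Definition closed_subspace_norm (x : closed_subspace) : K := `|x : Z|.

Lemma closed_subspace_normD x y :
  closed_subspace_norm (x + y) <=
    closed_subspace_norm x + closed_subspace_norm y.
Proof. exact: ler_normD. Qed.

Lemma closed_subspace_normZ (c : K) x :
  closed_subspace_norm (c *: x) = `|c| * closed_subspace_norm x.
Proof. exact: normrZ. Qed.

Lemma closed_subspace_norm_eq0 x : closed_subspace_norm x = 0 -> x = 0.
Proof. by move=> /eqP; rewrite normr_eq0 => /eqP x0; exact/val_inj. Qed.

HB.instance Definition _ := Lmodule_isNormed.Build K closed_subspace
  closed_subspace_normD closed_subspace_normZ closed_subspace_norm_eq0.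

(** The image filter converges in Z, and closedness keeps its limit in W. *)
Lemma closed_subspace_complete (F : set_system closed_subspace) :
  ProperFilter F -> cauchy F -> cvg F.
Proof.
move=> FF /cauchy_ballP Fc.
have FZ : cvg (closed_subspace_val @ F).
  apply: cauchy_cvg; apply/cauchy_ballP => e e0.
  have [[P Q] /= [FP FQ] PQ] := Fc _ e0.
  exists (closed_subspace_val @` P, closed_subspace_val @` Q) => /=.
    by split; rewrite /= /nbhs/=; [apply: filterS FP|apply: filterS FQ] => z;
      exists z.
  move=> [_ _] /= [[x Px <-] [y Qy <-]].
  by have := PQ (x, y) (conj Px Qy); rewrite -!ball_normE.
have limW : lim (closed_subspace_val @ F) \in closed_submodule_pred W.
  apply: (@closed_cvg _ Z F _ _ [set` closed_submodule_pred W]) FZ.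
    exact: closed_submodule_closed.
  by apply: nearW => x; exact: closed_subspaceP.
apply/cvg_ex; exists (ClosedSubspace limW); apply/cvgrPdist_lt => e e0.
by move/cvgrPdist_lt : FZ => /(_ _ e0).
Qed.

HB.instance Definition _ :=
  Uniform_isComplete.Build closed_subspace closed_subspace_complete.

End closed_submodule.

(** * Factorization through a closed subspace and the two inclusions *)

Section factorization.
Variables (R : realType) (k : scalar_kind).
Local Notation K := (scalars R k).
Local Notation banach := (completeNormedModType K).

(** The largest subset of Z that U maps into the copy of Y. *)
Definition range_preimage (Y Z : banach)
    (U : Z -> linfty R k (dual_ball Y)) : {pred Z} :=
  mem [set z | exists y, U z = canonical_embedding y].

Lemma range_preimage_submod (Y Z : banach)
    (U : Z -> linfty R k (dual_ball Y)) :
  linear U -> submod_closed (range_preimage U).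
Proof.
move=> Ul; have Y0 : canonical_embedding (0 : Y) = 0.
  by apply/eqP; rewrite -normr_eq0 norm_canonical_embedding normr0.
split.
  rewrite inE; exists 0; rewrite Y0.
  by have := Ul (-1) 0 0; rewrite scaler0 addr0 scaleN1r addNr.
move=> a u v; rewrite !inE => -[y Uy] [z Uz]; exists (a *: y + z).
by rewrite Ul Uy Uz canonical_embedding_linear.
Qed.

Lemma canonical_range_closed (Y : banach) :
  closed (range (@canonical_embedding R k Y)).
Proof.
pose i := @canonical_embedding R k Y.
have iB x y : i x - i y = i (x - y).
  by rewrite -scaleN1r addrC -canonical_embedding_linear scaleN1r addrC.
move=> h hcl.
(* The neighbourhoods of h are pulled back to Y. This filter is proper because h is in the closure
   of the range, and Cauchy because i is isometric; its limit is sent to h. *)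
pose F : set_system Y := filter_from (nbhs h) (fun N => i @^-1` N).
have FF : ProperFilter F.
  apply: filter_from_proper => [|N /hcl[_ [[y _ <-] Ny]]]; last by exists y.
  apply: filter_from_filter; first by exists setT; exact: filterT.
  by move=> N M Nh Mh; exists (N `&` M) => //; exact: filterI.
have iF : i @ F --> h by move=> N Nh; exists N.
have /cauchy_cvg/cvg_ex[y Fy] : cauchy F.
  apply/cauchy_ballP => e e0; have e20 : 0 < e / 2 by rewrite divr_gt0.
  have FA : F (i @^-1` ball h (e / 2)).
    by exists (ball h (e / 2)) => //; exact: nbhsx_ballx.
  exists (i @^-1` ball h (e / 2), i @^-1` ball h (e / 2)) => // -[x z] /= [].
  rewrite -!ball_normE /= -(norm_canonical_embedding (x - z)) -/(i _) -iB.
  move=> hx hz.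
  rewrite -(subrKA h) (le_lt_trans (ler_normD _ _))// [ltRHS]splitr ltrD//.
  by rewrite distrC.
have [_ ic] := @canonical_embedding_bounded R k Y.
exists y => //; apply: (cvg_unique _ _ iF) => //.
by apply: cvg_trans (ic y); apply: cvg_app; exact: Fy.
Qed.

Lemma range_preimage_closed (Y Z : banach)
    (U : Z -> linfty R k (dual_ball Y)) :
  continuous U -> closed [set` range_preimage U].
Proof.
move=> Uc; have -> : [set` range_preimage U] =
    U @^-1` (range (@canonical_embedding R k Y)).
  apply/seteqP; split => z /=; rewrite inE.
    by move=> [y Uy]; exists y.
  by move=> [y _ Uy]; exists y.
by move/continuous_closedP : Uc; apply; exact: canonical_range_closed.
Qed.

(** Each coordinate is a functional bounded by the norm on W and extends to Z with the same bound;
    the common bound |z| keeps the family of values at z in [linfty]. *)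
Lemma canonical_embedding_extend (Z : banach) (W : closed_submodule Z) :
  exists2 E : Z -> linfty R k (dual_ball (closed_subspace W)),
    bounded_operators E &
    E \o @closed_subspace_val _ _ W =
      @canonical_embedding R k (closed_subspace W).
Proof.
pose j : {linear closed_subspace W -> Z} := val.
have ext (f : dual_ball (closed_subspace W)) : exists g : {linear Z -> K^o},
    (forall w, g (j w) = proj1_sig f w) /\ (forall v, `|g v| <= `|v|).
  have [h0 _] := svalP f.
  pose h : {linear closed_subspace W -> K^o} :=
    HB.pack (proj1_sig f : _ -> K^o)
      (GRing.isLinear.Build K (closed_subspace W) K^o *:%R _ h0.1).
  have hj w : `|h w| <= `|j w| by exact: dual_ballP.
  exact: (hahn_banach hj).
have [g gP] := choice ext.
have gb z :
    (fun f => g f z) \in @bounded_functions R k (dual_ball (closed_subspace W)).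
  by apply/bounded_functionsP; exists `|z| => f; exact: (gP f).2.
exists (fun z => Linfty (gb z)).
  apply: (@bounded_operators_le _ _ _ _ _ 1).
    by move=> a u v; apply/val_inj/funext => f /=; rewrite linearP.
  by move=> z; rewrite mul1r; apply: linfty_norm_le => // f; exact: (gP f).2.
by apply/funext => w; apply/val_inj/funext => f; exact: (gP f).1.
Qed.

Lemma injective_hull_composition_sub (A1 A2 : operator_ideal R k)
    (X Y : banach) :
  @injective_hull R k (ideal_composition A1 A2) X Y `<=`
  @ideal_composition R k (injective_hull A1) (injective_hull A2) X Y.
Proof.
move=> T [Tb [Z [V [U [A2V A1U TUV]]]]].
have [Ul Uc] := ideal_bounded A1U; have [Vl _] := ideal_bounded A2V.
pose W := ClosedSubmodule (range_preimage_submod Ul) (range_preimage_closed Uc).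
have VW x : V x \in closed_submodule_pred W.
  by rewrite inE; exists (T x); have /(congr1 (fun h => h x)) := TUV.
pose V0 x : closed_subspace W := ClosedSubspace (VW x).
have /choice[U0 U0P] (w : closed_subspace W) :
    exists y, U (closed_subspace_val w) = canonical_embedding y.
  by have := closed_subspaceP w; rewrite inE.
have [Er Erb EV] := canonical_embedding_extend W.
have idb (Q : banach) : bounded_operators (@idfun Q).
  by split=> // x; exact: cvg_id.
have valb : bounded_operators (@closed_subspace_val _ _ W).
  apply: (@bounded_operators_le _ _ _ _ _ 1) => // w.
  by rewrite mul1r.
have V0b : bounded_operators V0.
  have [r _ Vr] := bounded_operators_bound (ideal_bounded A2V).
  apply: (@bounded_operators_le _ _ _ _ _ r) => //.
  by move=> a x y; apply/val_inj; exact: Vl.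
(* Linearity and the bound are checked after the injective isometry into [linfty], where U0 becomes
   a restriction of U. *)
have U0b : bounded_operators U0.
  have [r _ Ur] := bounded_operators_bound (ideal_bounded A1U).
  apply: (@bounded_operators_le _ _ _ _ _ r) => [a x y|x].
    apply: canonical_embedding_inj; rewrite canonical_embedding_linear -!U0P.
    exact: Ul.
  by rewrite -norm_canonical_embedding -U0P; exact: Ur.
exists (closed_subspace W), V0, U0; split.
- split=> //.
  (* On W the extension [Er] is the embedding, so V0 may be replaced by V, which is in A2; [idfun]
     fills the remaining slot of [ideal_comp]. *)
  have -> : @canonical_embedding R k (closed_subspace W) \o V0 =
      Er \o V \o idfun.
    by rewrite -EV.
  exact: ideal_comp.
- split=> //.
  have -> : @canonical_embedding R k Y \o U0 =
      idfun \o U \o @closed_subspace_val _ _ W.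
    by apply/funext => w; rewrite /= -U0P.
  exact: ideal_comp.
- apply/funext => x; apply: canonical_embedding_inj.
  by rewrite /= -U0P; have /(congr1 (fun h => h x)) := TUV.
Qed.

Lemma composition_injective_hull_sub (A1 A2 : operator_ideal R k)
    (X Y : banach) :
  linfty_extension_property A1 \/ injective_ideal A2 ->
  @ideal_composition R k (injective_hull A1) (injective_hull A2) X Y `<=`
  @injective_hull R k (ideal_composition A1 A2) X Y.
Proof.
move=> hyp T [Z [V [U [[Vb A2V] [Ub A1U] ->]]]]; split.
  exact: bounded_operators_comp.
case: hyp => [ext|inj].
  (* The embedding of Z splits off from U and is absorbed by V, giving the product of U' and the
     embedded V. *)
  have [U' [A1U' UE _]] := ext _ _ _ A1U.
  exists (linfty R k (dual_ball Z)), (@canonical_embedding R k Z \o V), U'.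
  by split=> //; rewrite compA UE.
exists Z, V, (@canonical_embedding R k Y \o U); split=> //.
by rewrite -inj.
Qed.

End factorization.

Theorem theorem4p2 (R : realType) (k : scalar_kind)
    (A1 A2 : operator_ideal R k) :
  linfty_extension_property A1 \/ injective_ideal A2 ->
  injective_hull (ideal_composition A1 A2)
    = ideal_composition (injective_hull A1) (injective_hull A2).
Proof.
move=> hyp; apply: functional_extensionality_dep => X.
apply: functional_extensionality_dep => Y; apply/seteqP; split.
  exact: injective_hull_composition_sub.
exact: composition_injective_hull_sub.
Qed.
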